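(* Let $t,m\ge 3$ be integers and suppose there exists a transversal design $\mathrm{TD}(t,m)$. Then its Levi graph $\mathcal{T}_{t,m}$ is a finite simplicial graph with diameter $4$, girth $6$, and $(\max\{2,n\},6)$--branching, where $n:=\min\{t,m\}-2$.
   Context: A transversal design $\mathrm{TD}(t,m)$ consists of $tm$ many Points partitioned into $t$ many Parts each of size $m$, together with a collection of subsets of Points, called Blocks, such that each Block consists of exactly one Point from each Part and every pair of Points from distinct Parts belongs to exactly one Block. Its Levi graph $\mathcal{T}_{t,m}$ is the bipartite graph with one vertex for each Point and one vertex for each Block, and an edge between a Point and a Block exactly when the Point belongs to the Block. (The parameters $t,m$ do not in general determine the design or the graph; the claim is for the Levi graph of any such design.) For a vertex $x$ of a graph, $\operatorname{Lk}(x)$ denotes the set of neighbors of $x$. A subgraph is induced if it contains every edge of the ambient graph joining two of its vertices. Definition ($(r,k)$--branching). For $r\ge 1$ and $k\ge 5$, a finite simplicial graph $\Gamma$ has $(r,k)$--branching if every vertex has valence at least $r+1$ and for every induced path $P$ of length 1 or 2 with endpoints $u$ and $v$ the following holds: for every set $\{u_1,\dots,u_r\}$ of distinct vertices in $\operatorname{Lk}(u)\setminus P$ there exist a set $\{v_1,\dots,v_r\}$ of distinct vertices in $\operatorname{Lk}(v)\setminus P$ and cycle subgraphs $H_1,\dots,H_r$ of $\Gamma$ such that for all $i\ne j$: (i) $5\le |H_i|\le k$, where $|H_i|$ is the length of the cycle; (ii) $H_i$ contains $\{u_i,v_i\}\cup P$; (iii) $H_i\cap H_j=P$; and (iv) $\bigcup_i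 H_i$ is an induced subgraph of $\Gamma$. *)

(* Defs.v *)
From HB Require Import structures.
From mathcomp Require Import all_boot.

Set Implicit Arguments.
Unset Strict Implicit.
Unset Printing Implicit Defensive.

(* A finite graph is an adjacency relation on a finType; being simplicial     *)
(* means having neither loops nor (by construction) multiple edges.           *)
Definition simplicial (T : finType) (e : rel T) : Prop :=
  symmetric e /\ irreflexive e.

Definition Lk (T : finType) (e : rel T) (x : T) : {set T} := [set y | e x y].

Definition is_dist (T : finType) (e : rel T) (x y : T) (d : nat) : Prop :=
  (exists p : seq T, [/\ path e x p, last x p = y & size p = d]) /\
  (forall p : seq T, path e x p -> last x p = y -> d <= size p).

(* In particular, a graph with a diameter is nonempty and connected. *)
Definition is_diameter (T : finType) (e : rel T) (d : nat) : Prop :=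
  (forall x y : T, exists2 d' : nat, is_dist e x y d' & d' <= d) /\
  (exists x y : T, is_dist e x y d).

(* A cycle is given by the cyclic sequence of its distinct vertices, so that  *)
(* its length is the size of the sequence.                                    *)
Definition is_cycle (T : finType) (e : rel T) (c : seq T) : Prop :=
  [/\ 3 <= size c, uniq c & cycle e c].

Definition is_girth (T : finType) (e : rel T) (g : nat) : Prop :=
  (exists2 c : seq T, is_cycle e c & size c = g) /\
  (forall c : seq T, is_cycle e c -> g <= size c).

(* Edges are unordered pairs [set x; y]. *)
Record subgraph (T : finType) := Subgraph {
  verts : {set T};
  edges : {set {set T}}
}.

Definition sub_subgraph (T : finType) (G H : subgraph T) : Prop :=
  (verts G \subset verts H) /\ (edges G \subset edges H).

Definition cap_subgraph (T : finType) (G H : subgraph T) : subgraph T :=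
  Subgraph (verts G :&: verts H) (edges G :&: edges H).

Definition bigcup_subgraph (T I : finType) (H : I -> subgraph T) : subgraph T :=
  Subgraph (\bigcup_i verts (H i)) (\bigcup_i edges (H i)).

(* Only applied to subgraphs all of whose edges are edges of the graph e. *)
Definition induced (T : finType) (e : rel T) (H : subgraph T) : Prop :=
  forall x y : T,
    x \in verts H -> y \in verts H -> e x y -> [set x; y] \in edges H.

Definition path_graph (T : finType) (s : seq T) : subgraph T :=
  Subgraph [set x in s] [set [set z.1; z.2] | z in zip s (behead s)].

Definition cycle_graph (T : finType) (c : seq T) : subgraph T :=
  Subgraph [set x in c] [set [set z.1; z.2] | z in zip c (rot 1 c)].

Definition cycle_subgraph (T : finType) (e : rel T) (H : subgraph T) : Prop :=
  exists2 c : seq T, is_cycle e c & H = cycle_graph c.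

(* The path P has vertices u :: p, hence length size p and endpoints u and    *)
(* last u p. The number of edges of a cycle subgraph is its length.           *)
Definition branching (r k : nat) (T : finType) (e : rel T) : Prop :=
  [/\ 1 <= r, 5 <= k, simplicial e,
      forall x : T, r.+1 <= #|Lk e x|
    & forall (u : T) (p : seq T),
        let v := last u p in
        let P := path_graph (u :: p) in
        path e u p -> uniq (u :: p) -> 1 <= size p <= 2 -> induced e P ->
        forall us : 'I_r -> T,
          injective us -> (forall i, us i \in Lk e u :\: verts P) ->
        exists (vs : 'I_r -> T) (H : 'I_r -> subgraph T),
          [/\ injective vs,
              forall i, vs i \in Lk e v :\: verts P
            & forall i, cycle_subgraph e (H i)] /\
          [/\ forall i, 5 <= #|edges (H i)| <= k,
              forall i, [/\ us i \in verts (H i), vs i \in verts (H i)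
                          & sub_subgraph P (H i)],
              forall i j, i != j -> cap_subgraph (H i) (H j) = P
            & induced e (bigcup_subgraph H)]].

Record transversal_design (t m : nat) (Point : finType)
    (parts blocks : {set {set Point}}) : Prop := TransversalDesign {
  td_card : #|Point| = t * m;
  td_partition : partition parts [set: Point];
  td_card_parts : #|parts| = t;
  td_card_part : forall A, A \in parts -> #|A| = m;
  td_block_part : forall b A, b \in blocks -> A \in parts -> #|b :&: A| = 1;
  td_pair : forall A B x y,
    A \in parts -> B \in parts -> A != B -> x \in A -> y \in B ->
    exists! b, [/\ b \in blocks, x \in b & y \in b]
}.

Definition levi_vertex (Point : finType) (blocks : {set {set Point}}) : finType :=
  (Point + {b : {set Point} | b \in blocks})%type.

Definition levi (Point : finType) (blocks : {set {set Point}}) :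
    rel (levi_vertex blocks) :=
  fun x y =>
    match x, y with
    | inl p, inr b => p \in val b
    | inr b, inl p => p \in val b
    | _, _ => false
    end.

(* Main.v *)
Require Import Defs.
From HB Require Import structures.
From mathcomp Require Import all_boot.

(* The union of the H_i is a union of hexagons p b q_i c_i z_i d_i of points  *)
(* and blocks, p, q_i in b, q_i, z_i in c_i and z_i, p in d_i. Since two      *)
(* points lie on at most one block, almost all incidences between different   *)
(* hexagons are excluded automatically, and the z_i only have to be chosen in *)
(* suitable parts:                                                            *)
(* - if P is the edge pb, all z_i are taken in one part avoiding p and all    *)
(*   q_i, which exists when r + 1 < t; otherwise r = 2, and z_i is taken in   *)
(*   the part of the other q_j;                                               *)
(* - if P = p b q, so that q_i = q, all z_i are taken in one part avoiding p  *)
(*   and q;                                                                   *)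
(* - if P = b p d, so that d_i = d, then z_i is the point of d in the part of *)
(*   q_(i+1), indices being cyclic.                                           *)

Set Implicit Arguments.
Unset Strict Implicit.
Unset Printing Implicit Defensive.

(** The whole argument rests on three facts: a block has exactly one point in each part ([meet],
    [meet_uniq]), points of different parts lie on a common block ([join]), and two distinct points
    lie on at most one block ([join_uniq]).

    Diameter: passing through a point of a suitable other part gives walks of length at most 4, and
    two distinct points of one part share no block, so they are at distance 4. Girth: the graph is
    bipartite, and a 4-cycle would be two points on two blocks. A 6-cycle is a triangle whose three
    points are not on one block; it exists because a part has several points and a block takes only
    one of them.

    Branching: by [branching_of_hexagons] it suffices to find induced hexagons through P that, away
    from P, are pairwise disjoint and joined by no edge. A triangle never has a chord
    ([hexagon_induced]), so only incidences between different hexagons matter; [levi_hexagons] lists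
    them. [edge_hexagons], [point_path_hexagons] and [block_path_hexagons] find the hexagons for the
    possible shapes of P, and [levi_branching] combines them. The bound on r enters through the
    valences and through [crossing_parts], which needs either a part free of r + 1 given points or r
    = 2. *)

Lemma ordS_neq (r : nat) (i : 'I_r) : 1 < r -> ordS i != i.
Proof.
move=> r_gt1; rewrite -val_eqE /=.
have := ltn_ord i; rewrite leq_eqVlt => /predU1P[ir | lt_ir].
  by rewrite ir modnn; apply: contraTneq r_gt1 => i0; rewrite -ir -i0.
by rewrite modn_small // gtn_eqF.
Qed.

Lemma inj_family_in (T : finType) (A : {set T}) (r : nat) : r <= #|A| ->
  exists f : 'I_r -> T, injective f /\ forall i, f i \in A.
Proof.
move=> le_rA; exists (fun i => enum_val (widen_ord le_rA i)).
split=> [i j /enum_val_inj/(congr1 val) /= ij | i]; last exact: enum_valP.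
exact: val_inj.
Qed.

(** * Walks, induced subgraphs and cycles in a finite graph *)

Section Graph.

Variables (T : finType) (e : rel T).

(** Having a walk of a given length is decidable, since tuples over [T] form a finite type, so a
    least length exists. *)
Lemma is_dist_le (x y : T) (p : seq T) : path e x p -> last x p = y ->
  exists2 d, is_dist e x y d & d <= size p.
Proof.
move=> xp lxp.
pose D d := [exists q : d.-tuple T, path e x q && (last x q == y)].
have walkD q : path e x q -> last x q = y -> D (size q).
  by move=> xq lq; apply/existsP; exists (in_tuple q); rewrite xq lq eqxx.
have exD : exists d, D d by exists (size p); exact: walkD.
case: (ex_minnP exD) => d /existsP[q /andP[xq /eqP lq]] min_d.
exists d; last exact/min_d/walkD.
split=> [|q' xq' lq']; last exact/min_d/walkD.
by exists q; rewrite size_tuple.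
Qed.

Lemma path_zip (x : T) (p : seq T) (z : T * T) : path e x p ->
  z \in zip (x :: p) p -> [/\ z.1 \in x :: p, z.2 \in x :: p & e z.1 z.2].
Proof.
elim: p x => // y p IHp x /= /andP[exy yp].
rewrite in_cons => /predU1P[-> | zp].
  by rewrite /= !inE !eqxx orbT.
by have [z1 z2 ez] := IHp y yp zp; rewrite in_cons z1 (in_cons x) z2 !orbT.
Qed.

Lemma cycle_zip (c : seq T) (z : T * T) : cycle e c ->
  z \in zip c (rot 1 c) -> [/\ z.1 \in c, z.2 \in c & e z.1 z.2].
Proof.
case: c => [|x c] //; rewrite rot1_cons => /path_zip-/(_ z).
(* The first list is the longer one, so its last entry, the repeated [x], has no partner. *)
have ->: zip (x :: rcons c x) (rcons c x) = zip (x :: c) (rcons c x).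
  rewrite -rcons_cons -(cats1 (x :: c)) -[in LHS](cats0 (rcons c x)).
  by rewrite zip_cat ?size_rcons //= cats0.
have sub_c y : y \in x :: rcons c x -> y \in x :: c.
  by rewrite in_cons mem_rcons => /predU1P[->|//]; rewrite mem_head.
by move=> zipP /zipP[/sub_c z1 /sub_c z2 ez].
Qed.

(** An edge set that depends on [S] only through [E \subset S]. This makes it commute with
    intersections, so that identities between induced subgraphs reduce to identities between vertex
    sets. *)
Definition induced_edges (S : {set T}) : {set {set T}} :=
  [set E in powerset S | [exists x, exists y, e x y && (E == [set x; y])]].

Lemma mem_induced_edges (S : {set T}) (x y : T) :
  x \in S -> y \in S -> e x y -> [set x; y] \in induced_edges S.
Proof.
move=> xS yS exy; rewrite inE powersetE subUset !sub1set xS yS /=.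
by apply/existsP; exists x; apply/existsP; exists y; rewrite exy eqxx.
Qed.

Lemma induced_edgesP (S E : {set T}) : E \in induced_edges S ->
  exists x y, [/\ x \in S, y \in S, e x y & E = [set x; y]].
Proof.
rewrite inE powersetE => /andP[sES /existsP[x /existsP[y]]].
case/andP=> exy /eqP E_xy.
by move: sES; rewrite E_xy subUset !sub1set => /andP[]; exists x, y.
Qed.

Lemma induced_edgesI (S S' : {set T}) :
  induced_edges (S :&: S') = induced_edges S :&: induced_edges S'.
Proof. by apply/setP=> E; rewrite !inE subsetI andbACA andbb. Qed.

Lemma induced_edgesS (S S' : {set T}) :
  S \subset S' -> induced_edges S \subset induced_edges S'.
Proof.
move=> sSS'; apply/subsetP=> E; rewrite !inE => /andP[sES ->].
by rewrite (subset_trans sES).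
Qed.

Lemma edges_induced (H : subgraph T) : induced e H ->
  edges H \subset induced_edges (verts H) -> edges H = induced_edges (verts H).
Proof.
move=> indH sub; apply/eqP; rewrite eqEsubset sub; apply/subsetP=> E.
by case/induced_edgesP=> x [y [xH yH exy ->]]; apply: indH.
Qed.

Lemma edges_path_graph (x : T) (p : seq T) :
  path e x p -> induced e (path_graph (x :: p)) ->
  edges (path_graph (x :: p)) = induced_edges [set y in x :: p].
Proof.
move=> xp ind; apply: (edges_induced ind); apply/subsetP=> E /imsetP[z].
case/(path_zip xp) => z1 z2 ez ->.
by apply: mem_induced_edges; rewrite ?inE // -in_cons.
Qed.

Lemma edges_cycle_graph (c : seq T) :
  cycle e c -> induced e (cycle_graph c) ->
  edges (cycle_graph c) = induced_edges [set x in c].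
Proof.
move=> cyc ind; apply: (edges_induced ind); apply/subsetP=> E /imsetP[z].
by case/(cycle_zip cyc) => z1 z2 ez ->; apply: mem_induced_edges; rewrite ?inE.
Qed.

End Graph.

(** This excludes that an edge of a cycle is run through in both directions, which would make two
    steps of the cycle give the same unordered edge. *)
Lemma next_next_neq (T : eqType) (c : seq T) (x : T) :
  uniq c -> 2 < size c -> x \in c -> next c (next c x) != x.
Proof.
move=> uc c_gt2 /rot_to[i s c_s]; rewrite -!(next_rot i uc) c_s.
move: uc c_gt2; rewrite -(rot_uniq i) -(size_rot i) c_s.
case: s {c_s} => [|y [|z s]] //=; rewrite !inE !negb_or -!andbA eqxx.
by case/and3P=> xy xz _; rewrite (eq_sym y) (negPf xy) eqxx eq_sym.
Qed.

(** The map from consecutive pairs to unordered pairs is injective: pairs with equal first entries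
    are equal, and a pair and its reverse cannot both be consecutive in a cycle of length at least
    3. *)
Lemma card_edges_cycle_graph (T : finType) (c : seq T) :
  uniq c -> 2 < size c -> #|edges (cycle_graph c)| = size c.
Proof.
move=> uc c_gt2; have next_zip z : z \in zip c (rot 1 c) ->
    z.1 \in c /\ next c z.1 = z.2.
  by case/(cycle_zip (cycle_next uc)) => z1 _ /eqP.
rewrite card_in_imset => [|z z' /next_zip[zc nz] /next_zip[z'c nz'] eq_zz'].
  have /card_uniqP-> : uniq (zip c (rot 1 c)) by apply: zip_uniql.
  by rewrite size_zip size_rot minnn.
have: z.1 \in [set z'.1; z'.2] by rewrite -eq_zz' set21.
case/set2P=> z1.
  by rewrite [z]surjective_pairing -nz z1 nz' -surjective_pairing.
have: z'.1 \in [set z.1; z.2] by rewrite eq_zz' set21.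
case/set2P=> z'1.
  by rewrite [z']surjective_pairing -nz' z'1 nz -surjective_pairing.
by have := next_next_neq uc c_gt2 zc; rewrite nz -z'1 nz' -z1 eqxx.
Qed.

(** P and the hexagons are induced, so their edge sets are determined by their vertex sets, and
    intersections can be computed on vertices. The union is induced because an edge between two
    different hexagons has an end in P; as P lies in every hexagon, both ends then lie in a single
    hexagon, which is induced. *)
Lemma branching_of_hexagons (T : finType) (e : rel T) (r : nat) (u : T)
    (p : seq T) (c : 'I_r -> seq T) :
  let P := path_graph (u :: p) in
  let H i := cycle_graph (c i) in
  symmetric e -> path e u p -> induced e P ->
  (forall i, [/\ is_cycle e (c i), size (c i) = 6, induced e (H i)
               & {subset u :: p <= c i}]) ->
  (forall i j x, i != j -> x \in c i -> x \in c j -> x \in u :: p) ->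
  (forall i j x y, i != j -> x \in c i -> y \in c j -> e x y ->
     (x \in u :: p) || (y \in u :: p)) ->
  [/\ forall i, cycle_subgraph e (H i),
      forall i, 5 <= #|edges (H i)| <= 6,
      forall i, sub_subgraph P (H i),
      forall i j, i != j -> cap_subgraph (H i) (H j) = P
    & induced e (bigcup_subgraph H)].
Proof.
move=> P H sym_e up indP hexH capH crossH.
have edgesH i : edges (H i) = induced_edges e [set x in c i].
  by have [[_ _ cyc] _ ind _] := hexH i; apply: edges_cycle_graph.
have edgesP : edges P = induced_edges e [set x in u :: p].
  exact: edges_path_graph.
have sPH i : [set x in u :: p] \subset [set x in c i].
  by apply/subsetP=> x; rewrite !inE -in_cons; have [_ _ _] := hexH i; apply.
split=> [i|i|i|i j neq_ij|x y /bigcupP[i _ xi] /bigcupP[j _ yj] exy].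
- by have [cyc _ _ _] := hexH i; exists (c i).
- have [[_ uc _] size_c _ _] := hexH i.
  by rewrite card_edges_cycle_graph ?size_c.
- by split; rewrite ?sPH // edgesH edgesP induced_edgesS.
- have capV : [set x in c i] :&: [set x in c j] = [set x in u :: p].
    apply/eqP; rewrite eqEsubset subsetI !sPH /= andbT.
    by apply/subsetP=> x; rewrite !inE -in_cons => /andP[]; apply: capH.
  rewrite /cap_subgraph !edgesH -induced_edgesI capV -edgesP.
  by congr Subgraph.
have edge_in k : x \in c k -> y \in c k ->
    [set x; y] \in edges (bigcup_subgraph H).
  move=> xk yk; apply/bigcupP; exists k => //.
  by rewrite edgesH mem_induced_edges ?inE.
move: xi yj; rewrite !inE => xi yj.
have [eq_ij | neq_ij] := eqVneq i j.
  by apply: (edge_in i); rewrite // eq_ij.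
have sub k : {subset u :: p <= c k} by case: (hexH k).
case/orP: (crossH i j x y neq_ij xi yj exy) => [/(sub j) xj | /(sub i) yi].
  exact: edge_in xj yj.
exact: edge_in xi yi.
Qed.

(** * Points, parts and blocks of the transversal design *)

Section Levi.

Variables (t m : nat) (Point : finType) (parts blocks : {set {set Point}}).
Hypotheses (t_ge3 : 3 <= t) (m_ge3 : 3 <= m).
Hypothesis design : transversal_design t m parts blocks.

Local Notation block := {b : {set Point} | b \in blocks}.
Local Notation vertex := (levi_vertex blocks).
Local Notation L := (@levi Point blocks).
Local Notation part := (pblock parts).
Local Notation pt := (@inl Point block).
Local Notation bl := (@inr Point block).

Implicit Types (p q x y z : Point) (b c d : block) (A : {set Point}).

Lemma part_in x : part x \in parts.
Proof.
by apply: pblock_mem; rewrite (cover_partition (td_partition design)) inE.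
Qed.

Lemma mem_part x : x \in part x.
Proof. by rewrite mem_pblock (cover_partition (td_partition design)) inE. Qed.

Lemma part_def A x : A \in parts -> x \in A -> part x = A.
Proof. by apply: def_pblock; case/and3P: (td_partition design). Qed.

Lemma meet b A : A \in parts -> exists2 x, x \in val b & part x = A.
Proof.
move=> Aparts; have /eqP/cards1P[x bA] := td_block_part design (valP b) Aparts.
have: x \in val b :&: A by rewrite bA set11.
by case/setIP=> xb xA; exists x; rewrite ?(part_def Aparts).
Qed.

Lemma meet_uniq b x y : x \in val b -> y \in val b -> part x = part y -> x = y.
Proof.
move=> xb yb xy.
have /eqP/cards1P[z bA] := td_block_part design (valP b) (part_in x).
have: x \in val b :&: part x by rewrite inE xb mem_part.
have: y \in val b :&: part x by rewrite inE yb xy mem_part.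
by rewrite bA => /set1P-> /set1P->.
Qed.

Lemma part_neq b x y :
  x \in val b -> y \in val b -> x != y -> part x != part y.
Proof. by move=> xb yb; apply: contra_neq => /(meet_uniq xb yb). Qed.

Lemma join x y : part x != part y ->
  exists2 b : block, x \in val b & y \in val b.
Proof.
move=> xy; have [b [[bB xb yb] _]] :=
  td_pair design (part_in x) (part_in y) xy (mem_part x) (mem_part y).
by exists (exist _ b bB).
Qed.

Lemma join_uniq b c x y : x != y -> x \in val b -> y \in val b ->
  x \in val c -> y \in val c -> b = c.
Proof.
move=> xy xb yb xc yc; have neq_parts := part_neq xb yb xy.
have [d [_ d_uniq]] :=
  td_pair design (part_in x) (part_in y) neq_parts (mem_part x) (mem_part y).
apply: val_inj; rewrite -(d_uniq (val b)); last by split=> //; apply: valP.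
by apply: d_uniq; split=> //; apply: valP.
Qed.

Lemma part_avoiding (S : {set {set Point}}) : #|S| < t ->
  exists2 A, A \in parts & A \notin S.
Proof.
rewrite -(td_card_parts design) => lt_S; apply/subsetPn.
by apply: contraL lt_S => /subset_leq_card; rewrite -leqNgt.
Qed.

Lemma exists_part : exists A, A \in parts.
Proof.
have [|A] := @part_avoiding set0; last by exists A.
by rewrite cards0; case: t t_ge3.
Qed.

Lemma third_part x y :
  exists A, [/\ A \in parts, A != part x & A != part y].
Proof.
have [|A Aparts] := @part_avoiding [set part x; part y].
  by rewrite cards2 (leq_trans _ t_ge3) // ltnS; case: (_ != _).
by rewrite !inE negb_or => /andP[Ax Ay]; exists A.
Qed.

Lemma levi_simplicial : simplicial L.
Proof. by split=> [[x|b] [y|c]|[x|b]]. Qed.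

(** Take a part [A] without [x]. Each point of [A] is joined to [x] by a block, so sending a block
    to its point in [A] maps the blocks through [x] onto [A]. *)
Lemma card_Lk_point x : m <= #|Lk L (pt x)|.
Proof.
have [A [Aparts xA _]] := third_part x x.
have [f fP] := fin_all_exists (fun b : block =>
  let: ex_intro2 z zb zA := meet b Aparts in
  ex_intro (fun z => z \in val b /\ part z = A) z (conj zb zA)).
have ->: Lk L (pt x) = bl @: [set b : block | x \in val b].
  apply/setP=> -[y|b]; rewrite inE /=.
    by apply/esym/imsetP=> -[].
  by rewrite mem_imset ?inE // => ? ? [].
rewrite card_imset => [|? ? []] //; apply: leq_trans (leq_imset_card f _).
rewrite -(td_card_part design Aparts); apply/subset_leq_card/subsetP=> y yA.
have yE := part_def Aparts yA; have [|b xb yb] := @join x y.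
  by rewrite yE eq_sym.
have [fb fA] := fP b; apply/imsetP; exists b; rewrite ?inE //.
by apply: (meet_uniq yb fb); rewrite fA.
Qed.

(** The points of a block represent all parts. *)
Lemma card_Lk_block b : t <= #|Lk L (bl b)|.
Proof.
have ->: Lk L (bl b) = pt @: val b.
  apply/setP=> -[y|c]; rewrite inE /=.
    by rewrite mem_imset ?inE // => ? ? [].
  by apply/esym/imsetP=> -[].
rewrite card_imset => [|? ? []] //; apply: leq_trans (leq_imset_card part _).
rewrite -(td_card_parts design); apply/subset_leq_card/subsetP=> A Aparts.
by have [x xb <-] := meet b Aparts; apply: imset_f.
Qed.

(** * Distances in the Levi graph *)

Lemma part_point A : A \in parts -> exists x, part x = A.
Proof.
move=> Aparts; have: 0 < #|A|.
  by rewrite (td_card_part design Aparts) ltnW // ltnW.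
by case/card_gt0P=> x xA; exists x; apply: part_def.
Qed.

(** A point in a third part is joined to both [x] and [y], even when these lie in the same part. *)
Lemma walk_point_point x y : exists w : seq vertex,
  [/\ path L (pt x) w, last (pt x) w = pt y & size w <= 4].
Proof.
have [A [/part_point[z <-] zx zy]] := third_part x y.
have [b zb xb] := join zx; have [c zc yc] := join zy.
by exists [:: bl b; pt z; bl c; pt y]; rewrite /= xb zb zc yc.
Qed.

Lemma walk_point_block x b : exists w : seq vertex,
  [/\ path L (pt x) w, last (pt x) w = bl b & size w <= 4].
Proof.
have [A [Aparts Ax _]] := third_part x x.
have [y yb yA] := meet b Aparts; rewrite -yA in Ax; have [c yc xc] := join Ax.
by exists [:: bl c; pt y; bl b]; rewrite /= xc yc yb.
Qed.

Lemma walk_block_point b x : exists w : seq vertex,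
  [/\ path L (bl b) w, last (bl b) w = pt x & size w <= 4].
Proof.
have [A [Aparts Ax _]] := third_part x x.
have [y yb yA] := meet b Aparts; rewrite -yA in Ax; have [c yc xc] := join Ax.
by exists [:: pt y; bl c; pt x]; rewrite /= xc yc yb.
Qed.

(** Points of [b] and of [c] can be picked in different parts and are then joined by a block. *)
Lemma walk_block_block b c : exists w : seq vertex,
  [/\ path L (bl b) w, last (bl b) w = bl c & size w <= 4].
Proof.
have [A Aparts] := exists_part.
have [x xb _] := meet b Aparts; have [B [Bparts Bx _]] := third_part x x.
have [y yc yB] := meet c Bparts; rewrite -yB in Bx; have [d yd xd] := join Bx.
by exists [:: pt x; bl d; pt y; bl c]; rewrite /= xb xd yd yc.
Qed.

Lemma levi_diameter : is_diameter L 4.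
Proof.
have walk v v' : exists w, [/\ path L v w, last v w = v' & size w <= 4].
  case: v v' => [x|b] [y|c].
  - exact: walk_point_point.
  - exact: walk_point_block.
  - exact: walk_block_point.
  - exact: walk_block_block.
split=> [v v'|].
  have [w [vw lw w4]] := walk v v'; have [d dP le_d] := is_dist_le vw lw.
  by exists d; rewrite ?(leq_trans le_d).
have [A Aparts] := exists_part.
have: 1 < #|A| by rewrite (td_card_part design Aparts) ltnW.
case/card_gt1P=> x [y [/(part_def Aparts) xA /(part_def Aparts) yA xy]].
(* The ends are points, so only even lengths occur: length 0 would give [x = y], and length 2 a
   block with two points in the part [A]. *)
have far w : path L (pt x) w -> last (pt x) w = pt y -> 4 <= size w.
  case: w => [|[?|b] [|[z|?] [|[?|c] [|? ?]]]] //=; rewrite ?andbF //.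
    by move=> _ [xy']; rewrite xy' eqxx in xy.
  case/and3P=> xb zb _ [zy]; case/eqP: xy.
  by apply: (meet_uniq xb); rewrite -?zy // zy xA.
have [w [xw lw w4]] := walk (pt x) (pt y).
exists (pt x), (pt y); split=> //; exists w; split=> //.
by apply/eqP; rewrite eqn_leq w4 far.
Qed.

(** * Hexagons and girth *)

Definition hexagon p b q c z d : seq vertex :=
  [:: pt p; bl b; pt q; bl c; pt z; bl d].

Lemma hexagon_points p b q c z d x :
  (pt x \in hexagon p b q c z d) = (x \in [:: p; q; z]).
Proof. by rewrite !inE /= -!sum_eqE /= !orbF. Qed.

Lemma hexagon_blocks p b q c z d a :
  (bl a \in hexagon p b q c z d) = (a \in [:: b; c; d]).
Proof. by rewrite !inE. Qed.

(** The condition [z \notin val b] says that the triangle is not degenerate. It separates [z] from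
    [p] and [q], and forces the three blocks to differ: [c = d] would contain both [p] and [q] and
    hence be [b]. *)
Lemma hexagon_cycle p b q c z d :
  p \in val b -> q \in val b -> q \in val c -> z \in val c ->
  z \in val d -> p \in val d -> p != q -> z \notin val b ->
  is_cycle L (hexagon p b q c z d).
Proof.
move=> pb qb qc zc zd pd pq zb.
have pz : p != z by apply: contraNneq zb => <-.
have qz : q != z by apply: contraNneq zb => <-.
have bc : b != c by apply: contraNneq zb => ->.
have bd : b != d by apply: contraNneq zb => ->.
have cd : c != d.
  by apply: contraNneq bc => cd; apply/eqP/(join_uniq pq) => //; rewrite cd.
split=> //=; last by rewrite pb qb qc zc zd pd.
by rewrite !inE !negb_or /= pq pz bc bd qz cd.
Qed.

(** A chord would put [z] on [b], [p] on [c] or [q] on [d]; the last two give [c = b] or [d = b],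
    and so again [z] on [b]. *)
Lemma hexagon_induced p b q c z d :
  p \in val b -> q \in val b -> q \in val c -> z \in val c ->
  z \in val d -> p \in val d -> p != q -> z \notin val b ->
  induced L (cycle_graph (hexagon p b q c z d)).
Proof.
move=> pb qb qc zc zd pd pq zb.
have pz : p != z by apply: contraNneq zb => <-.
have qz : q != z by apply: contraNneq zb => <-.
have pc : p \notin val c.
  by apply: contraNN zb => pc; rewrite (join_uniq pq pb qb pc qc).
have qd : q \notin val d.
  by apply: contraNN zb => qd; rewrite (join_uniq pq pb qb pd qd).
have edge_pb x a : x \in [:: p; q; z] -> a \in [:: b; c; d] -> x \in val a ->
    [set pt x; bl a] \in edges (cycle_graph (hexagon p b q c z d)).
  rewrite !inE => /or3P[]/eqP-> /or3P[]/eqP->;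
    rewrite ?(negPf pc) ?(negPf qd) ?(negPf zb) // => _; apply/imsetP.
  - by exists (pt p, bl b); rewrite ?inE ?eqxx.
  - by exists (bl d, pt p); rewrite ?inE ?eqxx ?orbT //= setUC.
  - by exists (bl b, pt q); rewrite ?inE ?eqxx ?orbT //= setUC.
  - by exists (pt q, bl c); rewrite ?inE ?eqxx ?orbT.
  - by exists (bl c, pt z); rewrite ?inE ?eqxx ?orbT //= setUC.
  - by exists (pt z, bl d); rewrite ?inE ?eqxx ?orbT.
move=> [x|a] [y|a'] //; rewrite !in_set ?hexagon_points ?hexagon_blocks.
  exact: edge_pb.
by move=> aH yH ya; rewrite setUC edge_pb.
Qed.

Lemma levi_girth : is_girth L 6.
Proof.
split=> [|c [c_gt2 uc cyc]].
  have [A Aparts] := exists_part.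
  have [p _] := part_point Aparts.
  have [B [/part_point[q <-] qp _]] := third_part p p.
  have [b qb pb] := join qp; have [C [Cparts Cp Cq]] := third_part p q.
  (* The block [b] has one point in [C], while [C] has at least 3. *)
  have /subsetPn[z zC zb] : ~~ (C \subset val b).
    apply/negP=> /setIidPr bC; have := td_block_part design (valP b) Cparts.
    by rewrite bC (td_card_part design Cparts) => m1; have := m_ge3; rewrite m1.
  have zE := part_def Cparts zC; rewrite -zE in Cp Cq.
  have [c zc qc] := join Cq; have [d zd pd] := join Cp.
  exists (hexagon p b q c z d) => //; apply: hexagon_cycle => //.
  by apply: contraNneq qp => ->.
(* Lengths 3 and 5 contradict bipartiteness; in length 4 the two points lie on both blocks, so the
   blocks coincide. *)
rewrite leqNgt; apply/negP; case: c c_gt2 uc cyc => [|v1 [|v2 [|v3 c]]] // _.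
case: c => [|v4 [|v5 [|? ?]]] // uc cyc _; move: cyc.
- by case: v1 v2 v3 {uc} => [?|?] [?|?] [?|?]; rewrite /= ?andbF.
- case: v1 v2 v3 v4 uc => [x1|b1] [x2|b2] [x3|b3] [x4|b4] uc //=;
    rewrite ?andbF //.
    case/and5P=> x1b2 x3b2 x3b4 x1b4 _.
    have x13 : x1 != x3.
      by apply: contraTneq uc => ->; rewrite /= !inE eqxx orbT.
    have b24 := join_uniq x13 x1b2 x3b2 x1b4 x3b4.
    by move: uc; rewrite b24 /= !inE eqxx !orbT /= andbF.
  case/and5P=> x2b1 x2b3 x4b3 x4b1 _.
  have x24 : x2 != x4.
    by apply: contraTneq uc => ->; rewrite /= !inE eqxx !orbT /= andbF.
  have b13 := join_uniq x24 x2b1 x4b1 x2b3 x4b3.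
  by move: uc; rewrite b13 /= !inE eqxx !orbT.
by case: v1 v2 v3 v4 v5 {uc} => [?|?] [?|?] [?|?] [?|?] [?|?];
  rewrite /= ?andbF.
Qed.

(** * Families of hexagons sharing a path *)

(** All hexagons share [p] and [b], which belong to P, so only the vertices [q i], [z i], [c i],
    [d i] have to be compared between different indices. Allowing coincidences inside P lets one
    statement serve for edges and for paths of length 2. *)
Lemma levi_hexagons (r : nat) p b (q z : 'I_r -> Point) (c d : 'I_r -> block)
    (u : vertex) (w : seq vertex) :
  let P := path_graph (u :: w) in
  let C i := hexagon p b (q i) (c i) (z i) (d i) in
  let H i := cycle_graph (C i) in
  path L u w -> induced L P ->
  pt p \in u :: w -> bl b \in u :: w -> (forall i, {subset u :: w <= C i}) ->
  p \in val b -> (forall i, q i \in val b) -> (forall i, q i \in val (c i)) ->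
  (forall i, z i \in val (c i)) -> (forall i, z i \in val (d i)) ->
  (forall i, p \in val (d i)) -> (forall i, p != q i) ->
  (forall i, z i \notin val b) ->
  (forall i j x, i != j -> x \in [:: q i; z i] -> x \in [:: q j; z j] ->
     pt x \in u :: w) ->
  (forall i j a, i != j -> a \in [:: c i; d i] -> a \in [:: c j; d j] ->
     bl a \in u :: w) ->
  (forall i j x a, i != j -> x \in [:: q i; z i] -> a \in [:: c j; d j] ->
     x \in val a -> (pt x \in u :: w) || (bl a \in u :: w)) ->
  [/\ forall i, cycle_subgraph L (H i),
      forall i, 5 <= #|edges (H i)| <= 6,
      forall i, sub_subgraph P (H i),
      forall i j, i != j -> cap_subgraph (H i) (H j) = P
    & induced L (bigcup_subgraph H)].
Proof.
move=> P C H uw indP pS bS subC pb qb qc zc zd pd pq zb capP capB cross.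
have [sym_L _] := levi_simplicial.
have ptC i x : pt x \in C i -> x = p \/ x \in [:: q i; z i].
  by rewrite hexagon_points in_cons => /predU1P.
have blC i a : bl a \in C i -> a = b \/ a \in [:: c i; d i].
  by rewrite hexagon_blocks in_cons => /predU1P.
have crossV i j x a : i != j -> pt x \in C i -> bl a \in C j -> x \in val a ->
    (pt x \in u :: w) || (bl a \in u :: w).
  move=> neq_ij /ptC[-> | xi]; first by rewrite pS.
  move=> /blC[-> | aj]; [by rewrite bS orbT | exact: cross neq_ij xi aj].
apply: branching_of_hexagons => //
  [i | i j [x|a] neq_ij | i j [x|a] [y|a'] neq_ij //].
- split=> //; first exact: hexagon_cycle.
  exact: hexagon_induced.
- by move=> /ptC[-> // | xi] /ptC[-> // | xj]; apply: capP neq_ij xi xj.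
- by move=> /blC[-> // | ai] /blC[-> // | aj]; apply: capB neq_ij ai aj.
- exact: crossV neq_ij.
- rewrite eq_sym in neq_ij; move=> ai yj ya; rewrite orbC.
  exact: crossV neq_ij yj ai ya.
Qed.

Lemma Lk_point_family (r : nat) x (S : {set vertex}) (us : 'I_r -> vertex) :
  injective us -> (forall i, us i \in Lk L (pt x) :\: S) ->
  exists d : 'I_r -> block, [/\ injective d, forall i, us i = bl (d i),
    forall i, x \in val (d i) & forall i, bl (d i) \notin S].
Proof.
move=> inj_us usP; have /fin_all_exists[d dP] : forall i, exists d : block,
    [/\ us i = bl d, x \in val d & bl d \notin S].
  move=> i; move: (usP i); rewrite !inE.
  by case: (us i) => [y|d]; rewrite ?andbF // => /andP[]; exists d.
have usE i : us i = bl (d i) by case: (dP i).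
exists d; split=> // [i j dij | i | i]; try by case: (dP i).
by apply: inj_us; rewrite !usE dij.
Qed.

Lemma Lk_block_family (r : nat) b (S : {set vertex}) (us : 'I_r -> vertex) :
  injective us -> (forall i, us i \in Lk L (bl b) :\: S) ->
  exists q : 'I_r -> Point, [/\ injective q, forall i, us i = pt (q i),
    forall i, q i \in val b & forall i, pt (q i) \notin S].
Proof.
move=> inj_us usP; have /fin_all_exists[q qP] : forall i, exists q,
    [/\ us i = pt q, q \in val b & pt q \notin S].
  move=> i; move: (usP i); rewrite !inE.
  by case: (us i) => [q|d]; rewrite ?andbF // => /andP[]; exists q.
have usE i : us i = pt (q i) by case: (qP i).
exists q; split=> // [i j qij | i | i]; try by case: (qP i).
by apply: inj_us; rewrite !usE qij.
Qed.

Lemma Lk_family (r : nat) (v w : vertex) : r < t -> r < m ->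
  exists us : 'I_r -> vertex,
    injective us /\ forall i, us i \in Lk L v :\: [set w].
Proof.
move=> r_t r_m; apply: inj_family_in; rewrite -ltnS.
have: r < #|Lk L v|.
  case: v => [x|b]; first exact: leq_trans (card_Lk_point x).
  exact: leq_trans (card_Lk_block b).
by rewrite (cardsD1 w) => /leq_trans-> //; case: (_ \in _); rewrite ?leqnSn.
Qed.

(** [A i] is the part from which [z i] will be taken. The last condition prevents [z i] from lying
    on [c j] for [i != j]: the block [c j] already meets [A i] in [z j] or in [q j]. *)
Lemma crossing_parts (r : nat) p b (q : 'I_r -> Point) :
  1 < r -> r.+1 < t \/ r = 2 -> p \in val b -> (forall i, q i \in val b) ->
  (forall i, p != q i) -> injective q ->
  exists A : 'I_r -> {set Point},
    (forall i, [/\ A i \in parts, A i != part p & A i != part (q i)]) /\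
    forall i j, i != j -> A i = A j \/ A j = part (q i).
Proof.
move=> r_gt1 r_small pb qb pq inj_q; case: r_small => [r_t | r2].
  (* The point [p] and the [q i] occupy at most r + 1 parts. *)
  have [|A Aparts] := @part_avoiding (part p |: [set part (q i) | i in 'I_r]).
    apply: leq_ltn_trans r_t.
    rewrite cardsU1 -[in leqRHS]add1n leq_add ?leq_b1 //.
    by rewrite -[leqRHS]card_ord leq_imset_card.
  rewrite !inE negb_or => /andP[Ap Aq]; exists (fun=> A).
  split=> [i|]; last by left.
  by split=> //; apply: contraNneq Aq => ->; apply: imset_f.
(* For r = 2 the cyclic successor of an index is the other index. *)
exists (fun i => part (q (ordS i))); split=> [i | i j neq_ij].
  split; [exact: part_in | by rewrite (part_neq (qb _) pb) // eq_sym |].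
  by rewrite (part_neq (qb _) (qb _)) // (inj_eq inj_q) ordS_neq.
right; congr (part (q _)); apply/val_inj; subst r.
by case: i j neq_ij => [[|[|?]] ?] [[|[|?]] ?].
Qed.

(** The points [z] and blocks [c] depend on the [q i] and [d i] alone. The edge is then quantified
    as [u], [v] in either order, so that the starting end of P may be the point or the block. *)
Lemma edge_hexagons (r : nat) p b (q : 'I_r -> Point) (d : 'I_r -> block) :
  1 < r -> r.+1 < t \/ r = 2 -> p \in val b -> (forall i, q i \in val b) ->
  (forall i, p != q i) -> injective q ->
  (forall i, p \in val (d i)) -> (forall i, b != d i) -> injective d ->
  exists (z : 'I_r -> Point) (c : 'I_r -> block),
  forall u v : vertex, let P := path_graph [:: u; v] in
  L u v -> induced L P -> [:: u; v] =i [:: pt p; bl b] ->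
  let H i := cycle_graph (hexagon p b (q i) (c i) (z i) (d i)) in
  [/\ forall i, cycle_subgraph L (H i),
      forall i, 5 <= #|edges (H i)| <= 6,
      forall i, sub_subgraph P (H i),
      forall i j, i != j -> cap_subgraph (H i) (H j) = P
    & induced L (bigcup_subgraph H)].
Proof.
move=> r_gt1 r_small pb qb pq inj_q pd bd inj_d.
have [A [AP crossA]] := crossing_parts r_gt1 r_small pb qb pq inj_q.
have /fin_all_exists[z zP] : forall i, exists z,
    z \in val (d i) /\ part z = A i.
  move=> i; have [Aparts _ _] := AP i.
  by have [z zd zA] := meet (d i) Aparts; exists z.
have /fin_all_exists[c cP] : forall i, exists c : block,
    q i \in val c /\ z i \in val c.
  move=> i; have [_ _ Aq] := AP i; have [_ zA] := zP i.
  by rewrite -zA in Aq; have [c zc qc] := join Aq; exists c.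
have pz i : p != z i.
  by have [_ Ap _] := AP i; apply: contraNneq Ap => ->; have [_ ->] := zP i.
have zb i : z i \notin val b.
  apply: contraNN (bd i) => zb; have [zd _] := zP i.
  exact/eqP/(join_uniq (pz i)).
have neq_z i j : i != j -> z i != z j.
  apply: contra_neq => zij; apply/inj_d/(join_uniq (pz i)) => //.
    by case: (zP i).
  by rewrite zij; case: (zP j).
(* If [z i] were on [c j], then it would be the point of [c j] in [A i], which is [z j] or [q j]. *)
have zc i j : i != j -> z i \notin val (c j).
  move=> neq_ij; have [qc zc] := cP j; apply/negP=> zic.
  have neq_ji : j != i by rewrite eq_sym.
  have [Aij | Aiq] := crossA j i neq_ji.
    case/eqP: (neq_z i j neq_ij); apply: (meet_uniq zic zc).
    by case: (zP i) (zP j) => _ -> [_ ->].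
  case/negP: (zb i); rewrite (meet_uniq zic qc) //.
  by have [_ ->] := zP i.
have qd i j : q i \notin val (d j).
  apply: contraNN (bd j) => qd; exact/eqP/(join_uniq (pq i)).
have qc i j : i != j -> q i \notin val (c j).
  move=> neq_ij; have [qc zcj] := cP j; apply/negP=> qic.
  have qij : q i != q j by rewrite (inj_eq inj_q).
  by case/negP: (zb j); rewrite (join_uniq qij (qb i) (qb j) qic qc).
have zd i j : i != j -> z i \notin val (d j).
  move=> neq_ij; apply/negP=> zdj; case/eqP: neq_ij; apply/inj_d.
  by apply: (join_uniq (pz i)) => //; case: (zP i).
exists z, c => u v P uv indP uvE; apply: levi_hexagons => //.
- by rewrite /= uv.
- by rewrite uvE mem_head.
- by rewrite uvE !inE eqxx orbT.
- by move=> i x; rewrite uvE !inE => /orP[]/eqP->; rewrite eqxx ?orbT.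
- by move=> i; case: (cP i).
- by move=> i; case: (cP i).
- by move=> i; case: (zP i).
- move=> i j x neq_ij; rewrite !inE => /orP[]/eqP-> /orP[]/eqP x_j.
  + by case/eqP: neq_ij; apply: inj_q.
  + by case/negP: (zb j); rewrite -x_j.
  + by case/negP: (zb i); rewrite x_j.
  + by have := neq_z i j neq_ij; rewrite x_j eqxx.
- move=> i j a neq_ij; have [qci zci] := cP i; have [zdi _] := zP i.
  rewrite !inE => /orP[]/eqP-> /orP[]/eqP a_j.
  + by have := qc i j neq_ij; rewrite -a_j qci.
  + by have := qd i j; rewrite -a_j qci.
  + by have := zc i j neq_ij; rewrite -a_j zdi.
  + by case/eqP: neq_ij; apply: inj_d.
move=> i j x a neq_ij; rewrite !inE => /orP[]/eqP-> /orP[]/eqP->.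
- by rewrite (negPf (qc i j neq_ij)).
- by rewrite (negPf (qd i j)).
- by rewrite (negPf (zc i j neq_ij)).
by rewrite (negPf (zd i j neq_ij)).
Qed.

(** Since all [z i] lie in one part, [c j] contains no [z i] other than [z j]; this also makes [c]
    injective. The [c i] are the required neighbours of the end [q]. *)
Lemma point_path_hexagons (r : nat) p b q (d : 'I_r -> block) :
  let P := path_graph [:: pt p; bl b; pt q] in
  p \in val b -> q \in val b -> p != q -> induced L P ->
  (forall i, p \in val (d i)) -> (forall i, b != d i) -> injective d ->
  exists (z : 'I_r -> Point) (c : 'I_r -> block),
  let H i := cycle_graph (hexagon p b q (c i) (z i) (d i)) in
  [/\ injective c, forall i, q \in val (c i) & forall i, b != c i] /\
  [/\ forall i, cycle_subgraph L (H i),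
      forall i, 5 <= #|edges (H i)| <= 6,
      forall i, sub_subgraph P (H i),
      forall i j, i != j -> cap_subgraph (H i) (H j) = P
    & induced L (bigcup_subgraph H)].
Proof.
move=> P pb qb pq indP pd bd inj_d; have [A [Aparts Ap Aq]] := third_part p q.
have /fin_all_exists[z zP] : forall i, exists z, z \in val (d i) /\ part z = A.
  by move=> i; have [z zd zA] := meet (d i) Aparts; exists z.
have /fin_all_exists[c cP] : forall i, exists c : block,
    q \in val c /\ z i \in val c.
  move=> i; have [_ zA] := zP i; rewrite -zA in Aq.
  by have [c zc qc] := join Aq; exists c.
have pz i : p != z i.
  by apply: contraNneq Ap => ->; have [_ ->] := zP i.
have zb i : z i \notin val b.
  apply: contraNN (bd i) => zb; have [zd _] := zP i.
  exact/eqP/(join_uniq (pz i)).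
have bc i : b != c i by apply: contraNneq (zb i) => ->; case: (cP i).
have zd i j : i != j -> z i \notin val (d j).
  move=> neq_ij; apply/negP=> zdj; case/eqP: neq_ij; apply/inj_d.
  by apply: (join_uniq (pz i)) => //; case: (zP i).
have neq_z i j : i != j -> z i != z j.
  by move=> neq_ij; apply: contraNneq (zd i j neq_ij) => ->; case: (zP j).
have zc i j : i != j -> z i \notin val (c j).
  move=> neq_ij; have [_ zcj] := cP j.
  apply: contraNN (neq_z i j neq_ij) => zci.
  by apply/eqP/(meet_uniq zci zcj); case: (zP i) (zP j) => _ -> [_ ->].
have pc i : p \notin val (c i).
  have [qc _] := cP i; apply: contraNN (bc i) => pc.
  exact/eqP/(join_uniq pq).
have inj_c : injective c.
  move=> i j cij; apply: contraTeq (cP i).2 => neq_ij.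
  by rewrite cij zc.
exists z, c => H; split; first by split=> // i; case: (cP i).
apply: levi_hexagons => //.
- by rewrite /= pb qb.
- by rewrite !inE eqxx ?orbT.
- by rewrite !inE eqxx ?orbT.
- by move=> i x; rewrite !inE => /or3P[]/eqP->; rewrite eqxx ?orbT.
- by move=> i; case: (cP i).
- by move=> i; case: (cP i).
- by move=> i; case: (zP i).
- move=> i j x neq_ij; rewrite !inE => /orP[]/eqP-> /orP[]/eqP x_j;
    rewrite ?x_j ?eqxx ?orbT //.
  by have := neq_z i j neq_ij; rewrite x_j eqxx.
- move=> i j a neq_ij; rewrite !inE => /orP[]/eqP-> /orP[]/eqP a_j.
  + by case/eqP: neq_ij; apply: inj_c.
  + by have := pc i; rewrite a_j pd.
  + by have := pc j; rewrite -a_j pd.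
  + by case/eqP: neq_ij; apply: inj_d.
move=> i j x a neq_ij; rewrite !inE => /orP[]/eqP-> /orP[]/eqP->.
- by rewrite eqxx !orbT.
- by rewrite eqxx !orbT.
- by rewrite (negPf (zc i j neq_ij)).
by rewrite (negPf (zd i j neq_ij)).
Qed.

(** The cyclic shift keeps the part of [z i] different from those of [p] and [q i], and its
    injectivity makes the [z i] distinct. A foreign point on [c j] would give [c j] two points of
    [b] or two points of [d], hence make it equal to that block. *)
Lemma block_path_hexagons (r : nat) b p d (q : 'I_r -> Point) :
  let P := path_graph [:: bl b; pt p; bl d] in
  1 < r -> p \in val b -> p \in val d -> b != d -> induced L P ->
  (forall i, q i \in val b) -> (forall i, p != q i) -> injective q ->
  exists (z : 'I_r -> Point) (c : 'I_r -> block),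
  let H i := cycle_graph (hexagon p b (q i) (c i) (z i) d) in
  [/\ injective z, forall i, z i \in val d & forall i, p != z i] /\
  [/\ forall i, cycle_subgraph L (H i),
      forall i, 5 <= #|edges (H i)| <= 6,
      forall i, sub_subgraph P (H i),
      forall i j, i != j -> cap_subgraph (H i) (H j) = P
    & induced L (bigcup_subgraph H)].
Proof.
move=> P r_gt1 pb pd bd indP qb pq inj_q.
have /fin_all_exists[z zP] : forall i, exists z,
    z \in val d /\ part z = part (q (ordS i)).
  by move=> i; have [z zd zA] := meet d (part_in (q (ordS i))); exists z.
have /fin_all_exists[c cP] : forall i, exists c : block,
    q i \in val c /\ z i \in val c.
  move=> i; have [_ zA] := zP i; have [|c zc qc] := @join (z i) (q i).
    by rewrite zA (part_neq (qb _) (qb _)) // (inj_eq inj_q) ordS_neq.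
  by exists c.
have inj_z : injective z.
  move=> i j zij; have [[_ zi] [_ zj]] := (zP i, zP j).
  by apply/ordS_inj/inj_q/(meet_uniq (qb _) (qb _)); rewrite -zi -zj zij.
have pz i : p != z i.
  have [_ zA] := zP i; have := part_neq pb (qb (ordS i)) (pq _).
  by rewrite -zA; apply: contra_neq => ->.
have zb i : z i \notin val b.
  apply: contraNN bd => zb; have [zd _] := zP i.
  exact/eqP/(join_uniq (pz i)).
have qd i : q i \notin val d.
  apply: contraNN bd => qd; exact/eqP/(join_uniq (pq i)).
have qc i j : i != j -> q i \notin val (c j).
  move=> neq_ij; have [qc zcj] := cP j; apply/negP=> qic.
  have qij : q i != q j by rewrite (inj_eq inj_q).
  by case/negP: (zb j); rewrite (join_uniq qij (qb i) (qb j) qic qc).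
have zc i j : i != j -> z i \notin val (c j).
  move=> neq_ij; have [qcj zcj] := cP j; apply/negP=> zic.
  have zij : z i != z j by rewrite (inj_eq inj_z).
  case/negP: (qd j); have [[zdi _] [zdj _]] := (zP i, zP j).
  by rewrite (join_uniq zij zdi zdj zic zcj).
have cd i : c i != d by apply: contraNneq (qd i) => <-; case: (cP i).
exists z, c => H; split; first by split=> // i; case: (zP i).
apply: levi_hexagons => //.
- by rewrite /= pb pd.
- by rewrite !inE eqxx ?orbT.
- by rewrite !inE eqxx ?orbT.
- by move=> i x; rewrite !inE => /or3P[]/eqP->; rewrite eqxx ?orbT.
- by move=> i; case: (cP i).
- by move=> i; case: (cP i).
- by move=> i; case: (zP i).
- move=> i j x neq_ij; rewrite !inE => /orP[]/eqP-> /orP[]/eqP x_j.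
  + by case/eqP: neq_ij; apply: inj_q.
  + by case/negP: (zb j); rewrite -x_j.
  + by case/negP: (zb i); rewrite x_j.
  + by case/eqP: neq_ij; apply: inj_z.
- move=> i j a neq_ij; rewrite !inE => /orP[]/eqP-> /orP[]/eqP a_j.
  + by have := qc i j neq_ij; rewrite -a_j; case: (cP i) => ->.
  + by rewrite a_j eqxx !orbT.
  + by rewrite eqxx !orbT.
  + by rewrite eqxx !orbT.
move=> i j x a neq_ij; rewrite !inE => /orP[]/eqP-> /orP[]/eqP->.
- by rewrite (negPf (qc i j neq_ij)).
- by rewrite eqxx !orbT.
- by rewrite (negPf (zc i j neq_ij)).
by rewrite eqxx !orbT.
Qed.

(** * The branching property *)

Lemma hexagon_pt p b q c z d x : x \in [:: p; q; z] ->
  pt x \in verts (cycle_graph (hexagon p b q c z d)).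
Proof. by rewrite in_set hexagon_points. Qed.

Lemma hexagon_bl p b q c z d a : a \in [:: b; c; d] ->
  bl a \in verts (cycle_graph (hexagon p b q c z d)).
Proof. by rewrite in_set hexagon_blocks. Qed.

Lemma pt_neq (S : {set vertex}) x y : pt x \in S -> pt y \notin S -> x != y.
Proof. by move=> xS; apply: contraNneq => <-. Qed.

Lemma bl_neq (S : {set vertex}) b c : bl b \in S -> bl c \notin S -> b != c.
Proof. by move=> bS; apply: contraNneq => <-. Qed.

Lemma levi_branching (r : nat) : 1 < r -> r < t -> r < m ->
  r.+1 < t \/ r = 2 -> branching r 6 L.
Proof.
move=> r_gt1 r_t r_m r_small; split=> //; first exact: ltnW.
- exact: levi_simplicial.
- case=> [x|b]; first exact: leq_trans (card_Lk_point x).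
  exact: leq_trans (card_Lk_block b).
have headS (v : vertex) s : v \in verts (path_graph (v :: s)).
  by rewrite in_set mem_head.
have secondS (v v' : vertex) s : v' \in verts (path_graph [:: v, v' & s]).
  by rewrite in_set in_cons mem_head orbT.
move=> u [|v [|v2 [|? ?]]] v0 P //; rewrite {}/v0 /=.
- case: u v @P => [p|b] [p'|b'] P //; rewrite ?andbT;
    move=> inc _ _ indP us inj_us usP.
  + have [d [inj_d usE pd dS]] := Lk_point_family inj_us usP.
    (* When P is an edge, the neighbours at its far end can be chosen arbitrarily; when P has length
       2 they are determined by the hexagons. *)
    have [vs [inj_vs vsP]] := Lk_family (bl b') (pt p) r_t r_m.
    have [q [inj_q vsE qb qS]] := Lk_block_family inj_vs vsP.
    have pq i : p != q i by apply: pt_neq (qS i); apply: set11.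
    have bd i : b' != d i by apply: bl_neq (dS i); apply: secondS.
    have [z [c hexP]] :=
      edge_hexagons r_gt1 r_small inc qb pq inj_q pd bd inj_d.
    have [cyc card_E sub cap ind] := hexP (pt p) (bl b') inc indP (fun=> erefl).
    exists vs, (fun i => cycle_graph (hexagon p b' (q i) (c i) (z i) (d i))).
    split; split=> // i.
      by rewrite vsE !inE -!sum_eqE /= !orbF (eq_sym (q i)) pq; apply: qb.
    rewrite vsE usE; split; last exact: sub.
      by apply: hexagon_bl; rewrite !inE eqxx ?orbT.
    by apply: hexagon_pt; rewrite !inE eqxx ?orbT.
  + have [q [inj_q usE qb qS]] := Lk_block_family inj_us usP.
    have [vs [inj_vs vsP]] := Lk_family (pt p') (bl b) r_t r_m.
    have [d [inj_d vsE pd dS]] := Lk_point_family inj_vs vsP.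
    have pq i : p' != q i by apply: pt_neq (qS i); apply: secondS.
    have bd i : b != d i by apply: bl_neq (dS i); apply: set11.
    have [z [c hexP]] :=
      edge_hexagons r_gt1 r_small inc qb pq inj_q pd bd inj_d.
    have swap : [:: bl b; pt p'] =i [:: pt p'; bl b].
      by move=> v; rewrite !inE orbC.
    have [cyc card_E sub cap ind] := hexP (bl b) (pt p') inc indP swap.
    exists vs, (fun i => cycle_graph (hexagon p' b (q i) (c i) (z i) (d i))).
    split; split=> // i.
      by rewrite vsE !inE -!sum_eqE /= !orbF (eq_sym (d i)) bd; apply: pd.
    rewrite vsE usE; split; last exact: sub.
      by apply: hexagon_pt; rewrite !inE eqxx ?orbT.
    by apply: hexagon_bl; rewrite !inE eqxx ?orbT.
case: u v v2 @P => [p|b] [p'|b'] [q|d] P //; rewrite ?andbF ?andbT //.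
- case/andP=> pb qb nodup _ indP us inj_us usP.
  have pq : p != q by apply: contraTneq nodup => ->; rewrite !inE eqxx orbT.
  have [d [inj_d usE pd dS]] := Lk_point_family inj_us usP.
  have bd i : b' != d i by apply: bl_neq (dS i); apply: secondS.
  have [z [c [[inj_c qc bc] [cyc card_E sub cap ind]]]] :=
    point_path_hexagons pb qb pq indP pd bd inj_d.
  exists (fun i => bl (c i)),
    (fun i => cycle_graph (hexagon p b' q (c i) (z i) (d i))).
  split; split=> //.
  - by move=> i j [/inj_c].
  - move=> i; rewrite !inE -!sum_eqE /= !orbF (eq_sym (c i)) bc; exact: qc.
  move=> i; rewrite usE; split; last exact: sub.
    by apply: hexagon_bl; rewrite !inE eqxx ?orbT.
  by apply: hexagon_bl; rewrite !inE eqxx ?orbT.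
case/andP=> pb pd nodup _ indP us inj_us usP.
have bd : b != d by apply: contraTneq nodup => ->; rewrite !inE eqxx orbT.
have [q [inj_q usE qb qS]] := Lk_block_family inj_us usP.
have pq i : p' != q i by apply: pt_neq (qS i); apply: secondS.
have [z [c [[inj_z zd pz] [cyc card_E sub cap ind]]]] :=
  block_path_hexagons r_gt1 pb pd bd indP qb pq inj_q.
exists (fun i => pt (z i)),
  (fun i => cycle_graph (hexagon p' b (q i) (c i) (z i) d)).
split; split=> //.
- by move=> i j [/inj_z].
- move=> i; rewrite !inE -!sum_eqE /= !orbF (eq_sym (z i)) pz; exact: zd.
move=> i; rewrite usE; split; last exact: sub.
  by apply: hexagon_pt; rewrite !inE eqxx ?orbT.
by apply: hexagon_pt; rewrite !inE eqxx ?orbT.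
Qed.

End Levi.

Theorem proposition6p10 (t m : nat) (Point : finType)
    (parts blocks : {set {set Point}})
    (ht : 3 <= t) (hm : 3 <= m)
    (hD : transversal_design t m parts blocks) :
  let T := @levi Point blocks in
  let n := minn t m - 2 in
  [/\ simplicial T, is_diameter T 4, is_girth T 6
    & branching (maxn 2 n) 6 T].
Proof.
move=> T n; have min_ge3 : 3 <= minn t m by rewrite leq_min ht.
have r_min : maxn 2 n < minn t m.
  by rewrite gtn_max min_ge3 ltn_subrL (leq_trans _ min_ge3).
have [r_t r_m] : maxn 2 n < t /\ maxn 2 n < m.
  by move: r_min; rewrite leq_min => /andP.
split; [exact: levi_simplicial | exact: levi_diameter hD |
        exact: levi_girth hD |].
apply: (levi_branching ht hD) => //; first exact: leq_maxl.
(* Either r = 2, or r = n, which is at most t - 2. *)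
have [n_le2 | n_gt2] := leqP n 2; first by right.
by left; rewrite -[_.+2]addn2 subnK ?geq_minl // ltnW.
Qed.
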